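(* Let $L\subseteq\Sigma^*$ be a regular language and let $M$ be its minimal deterministic finite automaton. Assume that there are words $x,y,z_1,z_2\in\Sigma^*$ and states $q_1,q_2,q_3$ of $M$ such that: 1. $q_2\neq q_3$; 2. if $M$ starts in $q_1$ and reads $x$, it passes to $q_2$; 3. if $M$ starts in $q_2$ and reads $x$, it passes to $q_2$; 4. if $M$ starts in $q_1$ and reads $y$, it passes to $q_3$; 5. if $M$ starts in $q_3$ and reads $y$, it passes to $q_3$; 6. for every word $t\in(x|y)^*$ there is a word $t_1\in(x|y)^*$ such that if $M$ starts in $q_2$ and reads $tt_1$, it passes to $q_2$; 7. for every word $t\in(x|y)^*$ there is a word $t_1\in(x|y)^*$ such that if $M$ starts in $q_3$ and reads $tt_1$, it passes to $q_3$; 8. if $M$ starts in $q_2$ and reads $z_1$, it passes to an accepting state; 9. if $M$ starts in $q_2$ and reads $z_2$, it passes to a rejecting state; 10. if $M$ starts in $q_3$ and reads $z_1$, it passes to a rejecting state; 11. if $M$ starts in $q_3$ and reads $z_2$, it passes to an accepting state. Then $L$ cannot be recognized by a 1-way QFA.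
   Context: $(x|y)^*$ is the set of all finite concatenations of copies of $x$ and $y$ (including the empty word). In a deterministic finite automaton (DFA) a state is rejecting if it is not accepting. The minimal automaton of a regular language is the smallest (complete) DFA recognizing it. A 1-way quantum finite automaton (QFA) is a tuple $(Q,\Sigma,V,q_0,Q_{acc},Q_{rej})$: $Q$ is a finite set of states, $\Sigma$ a finite input alphabet, $q_0\in Q$ the starting state, $Q_{acc},Q_{rej}\subseteq Q$ are disjoint sets of accepting and rejecting states, and $Q_{non}=Q\setminus(Q_{acc}\cup Q_{rej})$. Let $l_2(Q)$ be the complex Hilbert space with orthonormal basis $\{|q\rangle: q\in Q\}$, and $E_{acc},E_{rej},E_{non}$ the spans of $\{|q\rangle\}$ for $q$ in $Q_{acc},Q_{rej},Q_{non}$ respectively. With endmarkers $\kappa,\$\notin\Sigma$ and $\Gamma=\Sigma\cup\{\kappa,\$\}$, $V$ assigns to each $a\in\Gamma$ a unitary map $V_a$ on $l_2(Q)$. On input $w\in\Sigma^*$ the automaton starts in $|q_0\rangle$ and reads the letters of $\kappa w\$$ in order. Reading $a$ in the current (unnormalized) superposition $\psi$ means: compute $V_a\psi$; the automaton accepts (and halts) with probability the squared norm of the projection of $V_a\psi$ onto $E_{acc}$, rejects (and halts) with probability the squared norm of its projection onto $E_{rej}$, and otherwise continues with the unnormalized superposition equal to the projection of $V_a\psi$ onto $E_{non}$. The probability of accepting (rejecting) $w$ is the sum of these acceptance (rejection) probabilities over all letters of $\kappa w\$$. A QFA recognizes $L$ with probability $p>\frac12$ if it accepts every $w\in L$ with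 probability $\geq p$ and rejects every $w\in\Sigma^*\setminus L$ with probability $\geq p$. $L$ is recognized by a QFA if this holds for some QFA and some $p>\frac12$. *)

(* Defs.v *)
From HB Require Import structures.
From mathcomp Require Import all_boot all_order all_algebra.
From mathcomp Require Import reals complex.

Set Implicit Arguments.
Unset Strict Implicit.
Unset Printing Implicit Defensive.

Import Order.TTheory GRing.Theory Num.Theory.

Local Open Scope ring_scope.

Definition language (Sigma : finType) := seq Sigma -> Prop.

(* Complete deterministic finite automata: the transition function is total. *)
Record dfa (Sigma : finType) := DFA {
  dfa_state : finType;
  dfa_init : dfa_state;
  dfa_trans : dfa_state -> Sigma -> dfa_state;
  dfa_acc : {set dfa_state}
}.

Definition dfa_read (Sigma : finType) (M : dfa Sigma) (q : dfa_state M)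
  (w : seq Sigma) : dfa_state M := foldl (@dfa_trans Sigma M) q w.

Definition dfa_recognizes (Sigma : finType) (M : dfa Sigma)
    (L : language Sigma) : Prop :=
  forall w, L w <-> dfa_read (dfa_init M) w \in dfa_acc M.

Definition regular (Sigma : finType) (L : language Sigma) : Prop :=
  exists M : dfa Sigma, dfa_recognizes M L.

Definition minimal_dfa (Sigma : finType) (L : language Sigma)
    (M : dfa Sigma) : Prop :=
  dfa_recognizes M L /\
  forall M' : dfa Sigma, dfa_recognizes M' L ->
    (#|dfa_state M| <= #|dfa_state M'|)%N.

(* t \in (x|y)^* *)
Definition in_star2 (Sigma : finType) (x y t : seq Sigma) : Prop :=
  exists2 s : seq (seq Sigma), {subset s <= [:: x; y]} & t = flatten s.

Inductive tape_symbol (Sigma : Type) : Type :=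
| Kappa
| Letter of Sigma
| Dollar.
Arguments Kappa {Sigma}.
Arguments Dollar {Sigma}.

Definition tape (Sigma : Type) (w : seq Sigma) : seq (tape_symbol Sigma) :=
  Kappa :: rcons (map (@Letter Sigma) w) Dollar.

(* l_2(Q) is the space of column vectors over R[i], R being the reals; the
   coordinate of |q> is enum_rank q. *)
Definition l2 (R : realType) (Q : finType) := 'cV[R[i]]_#|Q|.

Definition ket (R : realType) (Q : finType) (q : Q) : l2 R Q :=
  delta_mx (enum_rank q) 0.

(* Orthogonal projection onto the span of { |q> : q \in A }. *)
Definition proj (R : realType) (Q : finType) (A : {set Q}) (psi : l2 R Q) :
    l2 R Q :=
  \col_i (if enum_val i \in A then psi i 0 else 0).

Definition sqnorm (R : realType) (Q : finType) (psi : l2 R Q) : R :=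
  \sum_i ComplexField.Normc.normc (psi i 0) ^+ 2.

Record qfa (R : realType) (Sigma : finType) := QFA {
  qfa_state : finType;
  qfa_trans : tape_symbol Sigma -> 'M[R[i]]_#|qfa_state|;
  qfa_init : qfa_state;
  qfa_acc : {set qfa_state};
  qfa_rej : {set qfa_state};
  qfa_trans_unitary : forall a, qfa_trans a \is unitarymx;
  qfa_disjoint : [disjoint qfa_acc & qfa_rej]
}.

Definition qfa_non (R : realType) (Sigma : finType) (A : qfa R Sigma) :
  {set qfa_state A} := ~: (qfa_acc A :|: qfa_rej A).

(* Probability of halting in H (meant to be qfa_acc A or qfa_rej A) at some
   point while reading s from the unnormalized superposition psi. *)
Fixpoint halt_prob (R : realType) (Sigma : finType) (A : qfa R Sigma)
    (H : {set qfa_state A}) (psi : l2 R (qfa_state A))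
    (s : seq (tape_symbol Sigma)) : R :=
  if s is a :: s' then
    let phi := qfa_trans A a *m psi in
    sqnorm (proj H phi) + halt_prob H (proj (qfa_non A) phi) s'
  else 0.

Definition accept_prob (R : realType) (Sigma : finType) (A : qfa R Sigma)
    (w : seq Sigma) : R :=
  halt_prob (qfa_acc A) (ket R (qfa_init A)) (tape w).

Definition reject_prob (R : realType) (Sigma : finType) (A : qfa R Sigma)
    (w : seq Sigma) : R :=
  halt_prob (qfa_rej A) (ket R (qfa_init A)) (tape w).

Definition qfa_recognizes (R : realType) (Sigma : finType) (A : qfa R Sigma)
    (L : language Sigma) (p : R) : Prop :=
  (forall w, L w -> p <= accept_prob A w) /\
  (forall w, ~ L w -> p <= reject_prob A w).

Definition qfa_recognizable (R : realType) (Sigma : finType)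
    (L : language Sigma) : Prop :=
  exists (A : qfa R Sigma) (p : R), 1 / 2 < p /\ qfa_recognizes A L p.

(* Main.v *)
(* For a word t let T t be the non-halting evolution of the automaton along t, a
   contraction. Among the words u of (x|y)^* leading q1 to q2 and fixing q2,
   choose one for which 1 - (T u)^* T u has maximal rank. Condition 6 allows any
   t in (x|y)^* to be appended to u and completed to such a word again, so by
   maximality the kernel E of this matrix consists exactly of the vectors whose
   norm is preserved by T t for every t in (x|y)^*. The same holds for a word v
   chosen for q3, with the same E. On E the powers of T u return arbitrarily
   close to the identity (pigeonhole), on its orthogonal complement they tend to
   0, so some power of T u, and likewise of T v, sends a given vector close to
   its projection on E. Hence from q1 one reaches q2 and q3 by two words leaving
   the quantum automaton in nearly the same state phi. If those words halt with
   accepting/rejecting probabilities a2, r2 and a3, r3, appending z1 and z2 to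
   both gives four probabilities that are at least p, whose sum is close to
   (a2 + r2) + (a3 + r3) + 2 |phi|^2 = 2 at most, whereas 4p > 2. *)

Require Import Defs.
From HB Require Import structures.
From mathcomp Require Import all_boot all_order all_algebra.
From mathcomp Require Import boolp reals complex.
From mathcomp Require Import ring lra.

Set Implicit Arguments.
Unset Strict Implicit.
Unset Printing Implicit Defensive.

Import Order.TTheory GRing.Theory Num.Theory ComplexField.Normc.

Local Open Scope ring_scope.
Local Open Scope sesquilinear_scope.

(** * Inner products and contractions *)

Section InnerProduct.
Variable R : realType.
Local Notation C := R[i].
Implicit Types (n : nat).

(** Only the real part of the Hermitian product is kept: it is symmetric and additive,
    [ip v v = sq v], and adjoints still move across it. *)
Definition ip n (v w : 'cV[C]_n) : R := complex.Re ((v^t* *m w) 0 0).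

(* [sqnorm] in an arbitrary dimension. *)
Definition sq n (v : 'cV[C]_n) : R := \sum_i normc (v i 0) ^+ 2.

Lemma adjM m n p (A : 'M[C]_(m, n)) (B : 'M[C]_(n, p)) :
  (A *m B)^t* = B^t* *m A^t*.
Proof. by rewrite trmx_mul map_mxM. Qed.

Lemma adjB m n (A B : 'M[C]_(m, n)) : (A - B)^t* = A^t* - B^t*.
Proof. by rewrite raddfB map_mxB. Qed.

Lemma adj1 n : (1%:M : 'M[C]_n)^t* = 1%:M.
Proof. by rewrite trmx1 map_mx1. Qed.

Lemma ipE n (v w : 'cV[C]_n) :
  ip v w = \sum_i (complex.Re (v i 0) * complex.Re (w i 0)
                   + complex.Im (v i 0) * complex.Im (w i 0)).
Proof.
rewrite /ip mxE.
have -> : complex.Re (\sum_j (v^t*) 0 j * w j 0)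
  = \sum_j complex.Re ((v^t*) 0 j * w j 0).
  by apply: (big_morph (@complex.Re R)) => // -[a b] [c d].
apply: eq_bigr => i _; rewrite !mxE.
by case: (v i 0) (w i 0) => a b [c d] /=; ring.
Qed.

Lemma sqE n (v : 'cV[C]_n) : sq v = ip v v.
Proof.
rewrite ipE; apply: eq_bigr => i _; case: (v i 0) => a b /=.
by rewrite sqr_sqrtr ?addr_ge0 ?sqr_ge0 // !expr2.
Qed.

Lemma ipC n (v w : 'cV[C]_n) : ip v w = ip w v.
Proof. by rewrite !ipE; apply: eq_bigr => i _; ring. Qed.

Lemma ipDl n (u v w : 'cV[C]_n) : ip (u + v) w = ip u w + ip v w.
Proof. by rewrite /ip raddfD map_mxD mulmxDl mxE; case: (_ 0 0) (_ 0 0) => a b []. Qed.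

Lemma ipNl n (u w : 'cV[C]_n) : ip (- u) w = - ip u w.
Proof. by rewrite /ip raddfN map_mxN mulNmx mxE; case: (_ 0 0). Qed.

Lemma ip_adj m n (A : 'M[C]_(m, n)) v w : ip (A *m v) w = ip v (A^t* *m w).
Proof. by rewrite /ip adjM mulmxA. Qed.

Lemma sq_ge0 n (v : 'cV[C]_n) : 0 <= sq v.
Proof. by apply: sumr_ge0 => i _; rewrite sqr_ge0. Qed.

Lemma sq_eq0 n (v : 'cV[C]_n) : sq v = 0 -> v = 0.
Proof.
move=> /eqP; rewrite psumr_eq0 => [/allP h|i _]; last exact: sqr_ge0.
apply/colP => i; rewrite mxE; apply: eq0_normc; apply/eqP.
by have := h i (mem_index_enum _); rewrite sqrf_eq0.
Qed.

Lemma sqN n (v : 'cV[C]_n) : sq (- v) = sq v.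
Proof. by rewrite !sqE ipNl ipC ipNl opprK. Qed.

Lemma sqD n (v w : 'cV[C]_n) : sq (v + w) = sq v + sq w + 2 * ip v w.
Proof. by rewrite !sqE ipDl !(ipC _ (v + w)) !ipDl (ipC w v); ring. Qed.

Lemma sqB n (v w : 'cV[C]_n) : sq (v - w) = sq v + sq w - 2 * ip v w.
Proof. by rewrite sqD sqN ipC ipNl ipC; ring. Qed.

Lemma sqBC n (v w : 'cV[C]_n) : sq (v - w) = sq (w - v).
Proof. by rewrite -sqN opprB. Qed.

Lemma sqZ n (a : C) (v : 'cV[C]_n) : sq (a *: v) = normc a ^+ 2 * sq v.
Proof.
by rewrite mulr_sumr; apply: eq_bigr => i _; rewrite mxE normcM exprMn.
Qed.

Lemma sqD_le2 n (v w : 'cV[C]_n) : sq (v + w) <= 2 * sq v + 2 * sq w.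
Proof. by have := sq_ge0 (v - w); rewrite sqB sqD; lra. Qed.

(* AM-GM: [0 <= sq (d *: v - w)]. *)
Lemma sqD_le n (v w : 'cV[C]_n) (d : R) : 0 < d ->
  sq (v + w) <= (1 + d) * sq v + (1 + d^-1) * sq w.
Proof.
move=> d0.
have ipZ : ip (d%:C%C *: v) w = d * ip v w.
  rewrite !ipE mulr_sumr; apply: eq_bigr => i _; rewrite mxE.
  by case: (v i 0) (w i 0) => a b [c e] /=; ring.
have normd : normc d%:C%C ^+ 2 = d ^+ 2.
  by rewrite /= expr0n /= addr0 sqr_sqrtr ?sqr_ge0.
have := sq_ge0 (d%:C%C *: v - w); rewrite sqB sqZ normd ipZ => h.
have h' : 2 * ip v w <= d * sq v + d^-1 * sq w.
  rewrite -(ler_pM2l d0) mulrDr !mulrA mulfV ?gt_eqF // mul1r -expr2; lra.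
by rewrite sqD; lra.
Qed.

Lemma sq_coord n (v : 'cV[C]_n) i : normc (v i 0) ^+ 2 <= sq v.
Proof.
rewrite /sq (bigD1 i) //= lerDl; apply: sumr_ge0 => j _; exact: sqr_ge0.
Qed.

(** [A *m v] combines the columns of [A] with the coordinates of [v] as weights; the bound grows by
    induction on the list of columns. *)
Lemma mulmx_sq_bounded m n (A : 'M[C]_(m, n)) :
  exists M : R, forall v, sq (A *m v) <= M * sq v.
Proof.
have bnd (f : 'cV[C]_n -> 'cV[C]_m) : (forall v, f v = A *m v) ->
    (exists M : R, forall v, sq (f v) <= M * sq v) -> 
    exists M : R, forall v, sq (A *m v) <= M * sq v.
  by move=> e [M h]; exists M => v; rewrite -e.
pose f (v : 'cV[C]_n) := \sum_j v j 0 *: col j A.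
apply: (bnd f) => [v|].
  apply/colP => i; rewrite summxE mxE; apply: eq_bigr => j _.
  by rewrite !mxE mulrC.
rewrite /f; elim: (index_enum _) => [|j s [M hM]].
  exists 0 => v; rewrite big_nil mul0r.
  by rewrite /sq big1 // => i _; rewrite mxE normc0 expr0n.
exists (2 * sq (col j A) + 2 * M) => v; rewrite big_cons.
have h1 : sq (v j 0 *: col j A) <= sq (col j A) * sq v.
  by rewrite sqZ mulrC ler_wpM2l ?sq_ge0 // sq_coord.
by have := hM v; have := sqD_le2 (v j 0 *: col j A) (\sum_(i <- s) v i 0 *: col i A); lra.
Qed.

Definition contraction n (A : 'M[C]_n) := forall v, sq (A *m v) <= sq v.

(** The square of the usual defect operator: [ip v (defect A *m v)] equals [sq v - sq (A *m v)]. *)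
Definition defect n (A : 'M[C]_n) := 1%:M - A^t* *m A.

(** Expand [|A A^* v - v|^2 >= 0] and bound [|A A^* v|] by [|A^* v|]. *)
Lemma contraction_adj n (A : 'M[C]_n) : contraction A -> contraction (A^t*).
Proof.
move=> hA v; have := sq_ge0 (A *m (A^t* *m v) - v).
by rewrite sqB ip_adj -sqE; have := hA (A^t* *m v); lra.
Qed.

Lemma defect_herm n (A : 'M[C]_n) : (defect A)^t* = defect A.
Proof. by rewrite adjB adj1 adjM trmxCK. Qed.

(** The left side is [|v|^2 - 2 |A v|^2 + |A^* A v|^2], and [A^*] is a contraction. So a vector
    whose norm is nearly preserved is nearly killed by the defect. *)
Lemma defect_le n (A : 'M[C]_n) v : contraction A ->
  sq (defect A *m v) <= sq v - sq (A *m v).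
Proof.
move=> hA; rewrite mulmxBl mul1mx -mulmxA sqB -ip_adj -sqE.
by have := contraction_adj hA (A *m v); lra.
Qed.

Lemma defect_eq0 n (A : 'M[C]_n) v : contraction A ->
  defect A *m v = 0 <-> sq (A *m v) = sq v.
Proof.
move=> hA; split=> [|h].
  rewrite mulmxBl mul1mx => /subr0_eq h.
  by rewrite [RHS]sqE [X in ip _ X]h -mulmxA -ip_adj -sqE.
apply: sq_eq0; apply/eqP; rewrite eq_le sq_ge0 andbT.
by have := defect_le v hA; lra.
Qed.

End InnerProduct.

(** The columns of [cokermx B] are killed by [B]. Kernel inclusions thus become factorizations
    [A = X *m B] and rank comparisons. *)
Lemma submx_kerP (F : fieldType) m1 m2 n (A : 'M[F]_(m1, n)) (B : 'M[F]_(m2, n)) :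
  (A <= B)%MS <-> (forall v : 'cV_n, B *m v = 0 -> A *m v = 0).
Proof.
split=> [/submxP[X ->] v Bv|h]; first by rewrite -mulmxA Bv mulmx0.
rewrite submxE; apply/eqP/matrixP => i j; rewrite mxE.
have : B *m col j (cokermx B) = 0.
  by rewrite colE mulmxA mulmx_coker mul0mx.
by move=> /h /colP /(_ i); rewrite colE mulmxA -colE !mxE.
Qed.

(** * Orthogonal projections onto kernels of Hermitian matrices *)

Section OrthogonalProjection.
Variables (R : realType) (n : nat).
Local Notation C := R[i].

(* For Hermitian [G], [P] is the orthogonal projection onto the kernel of [G];
   the last clause bounds [v - P v] by a multiple of [G v]. *)
Definition ker_proj (G P : 'M[C]_n) :=
  [/\ P^t* = P, G *m P = 0 & exists Z, P = 1%:M - Z *m G].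

(** [G G] and [G] have the same kernel, so [G = Y G G] for some [Y]. With [P = 1 - G Y^*] one gets
    [G P = 0], hence [P^* = P^* P], which makes [P] Hermitian. *)
Lemma ker_proj_exists (G : 'M[C]_n) : G^t* = G -> exists P, ker_proj G P.
Proof.
move=> hG.
have /submxP[Y hY] : (G <= G *m G)%MS.
  apply/submx_kerP => v; rewrite -mulmxA => h.
  by apply: sq_eq0; rewrite sqE ip_adj hG h /ip mulmx0 mxE.
pose P := 1%:M - G *m Y^t*.
have hP : P^t* = 1%:M - Y *m G by rewrite adjB adj1 adjM trmxCK hG.
have GP : G *m P = 0.
  have GGY : G *m G *m Y^t* = G by rewrite -[RHS]hG [in RHS]hY !adjM hG.
  by rewrite mulmxBr mulmx1 mulmxA GGY subrr.
have PP : P^t* = P^t* *m P.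
  have PG : P^t* *m G = 0 by rewrite -[in LHS]hG -adjM GP trmx0 map_mx0.
  by rewrite [in RHS]mulmxBr mulmx1 mulmxA PG mul0mx subr0.
have Pherm : P^t* = P by rewrite -[RHS]trmxCK PP adjM trmxCK -PP.
by exists P; split=> //; exists Y; rewrite -Pherm.
Qed.

Lemma ker_projP (G P : 'M[C]_n) (v : 'cV_n) : ker_proj G P ->
  (G *m v = 0) <-> (P *m v = v).
Proof.
move=> [_ GP [Z hP]]; split=> [h|<-]; last by rewrite mulmxA GP mul0mx.
by rewrite hP mulmxBl mul1mx -mulmxA h mulmx0 subr0.
Qed.

Lemma ker_proj_idem (G P : 'M[C]_n) : ker_proj G P -> P *m P = P.
Proof.
by move=> [_ GP [Z hP]]; rewrite {1}hP mulmxBl mul1mx -mulmxA GP mulmx0 subr0.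
Qed.

(** Equal kernels give [Q P = P] and [P Q = Q]; the adjoint of the first is [P Q = P]. *)
Lemma ker_proj_uniq (G H P Q : 'M[C]_n) : ker_proj G P -> ker_proj H Q ->
  (forall v : 'cV_n, G *m v = 0 <-> H *m v = 0) -> P = Q.
Proof.
move=> hP hQ e.
have absorb (G' H' P' Q' : 'M[C]_n) : ker_proj G' P' -> ker_proj H' Q' ->
    (forall v : 'cV_n, G' *m v = 0 -> H' *m v = 0) -> Q' *m P' = P'.
  move=> [_ GP _] [_ _ [Z ->]] /submx_kerP /submxP[X ->].
  by rewrite mulmxBl mul1mx -!mulmxA GP !mulmx0 subr0.
have QP := absorb _ _ _ _ hP hQ (fun v => (e v).1).
have PQ := absorb _ _ _ _ hQ hP (fun v => (e v).2).
case: hP hQ => hP _ _ [hQ _ _].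
by rewrite -hP -QP adjM hP hQ PQ.
Qed.

End OrthogonalProjection.

(** * Powers of a contraction *)

(** Real and imaginary parts of the coordinates lie in a bounded interval, which is cut into
    finitely many cells of side [1 / N]; two of the vectors share all their cells. *)
Lemma pigeonhole_close (R : realType) n (v : nat -> 'cV[R[i]]_n) (b e : R) :
    (forall k, sq (v k) <= b) -> 0 < e ->
  exists i j, (i < j)%N /\ sq (v i - v j) <= e.
Proof.
move=> vb e0.
(* [z^2 <= b] implies [|z| <= b + 1], which avoids a square root. *)
pose c := b + 1.
have b0 : 0 <= b := le_trans (sq_ge0 _) (vb 0%N).
have coord (k : nat) (i : 'I_n) :
    (`|complex.Re (v k i 0)| <= c) /\ (`|complex.Im (v k i 0)| <= c).
  have := le_trans (sq_coord (v k) i) (vb k).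
  case: (v k i 0) => x y /=; rewrite sqr_sqrtr ?addr_ge0 ?sqr_ge0 // => h.
  have abs_le (z : R) : z ^+ 2 <= b -> `|z| <= c.
    by move=> hz; rewrite /c ler_norml; apply/andP; split; nra.
  by split; apply: abs_le; have := sqr_ge0 x; have := sqr_ge0 y; lra.
(* Each of the [n] coordinates will contribute at most [2 / N^2], and [2 n / N <= e]. *)
pose N := (Num.truncn (2 * n%:R / e)).+1.
have N0 : 0 < N%:R :> R by rewrite ltr0n.
have N1 : 1 <= N%:R :> R by rewrite ler1n.
have hN : 2 * n%:R <= e * N%:R.
  by rewrite -ler_pdivrMl // mulrC ltW // truncnS_gt.
pose m := Num.truncn ((c + c) * N%:R).
pose g (x : R) : 'I_m.+1 := inord (Num.truncn ((x + c) * N%:R)).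
have gP (x y : R) : `|x| <= c -> `|y| <= c -> g x = g y ->
    (x - y) ^+ 2 <= N%:R^-1 ^+ 2.
  rewrite !ler_norml => /andP[x1 x2] /andP[y1 y2] /(congr1 val).
  have bd (z : R) : - c <= z -> z <= c ->
      (Num.truncn ((z + c) * N%:R) < m.+1)%N.
    move=> z1 z2; rewrite ltnS; apply: le_truncn.
    by apply: ler_wpM2r; [exact: ltW | lra].
  rewrite /g /= !inordK ?bd // => exy.
  have /andP[x3 x4] : (Num.truncn ((x + c) * N%:R))%:R <= (x + c) * N%:R
      < (Num.truncn ((x + c) * N%:R)).+1%:R.
    by apply: truncn_itv; rewrite mulr_ge0 ?(ltW N0) //; lra.
  have /andP[y3 y4] : (Num.truncn ((y + c) * N%:R))%:R <= (y + c) * N%:R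
      < (Num.truncn ((y + c) * N%:R)).+1%:R.
    by apply: truncn_itv; rewrite mulr_ge0 ?(ltW N0) //; lra.
  rewrite -exy in y3 y4; move: x4 y4; rewrite -natr1 => x4 y4.
  have h1 : (x - y) * N%:R <= 1 by lra.
  have h2 : - 1 <= (x - y) * N%:R by lra.
  have h3 : x - y <= N%:R^-1 by rewrite -[_^-1]div1r ler_pdivlMr.
  have h4 : - N%:R^-1 <= x - y by rewrite -[_^-1]div1r -mulNr ler_pdivrMr.
  nra.
pose f (k : nat) : {ffun 'I_n -> 'I_m.+1 * 'I_m.+1} :=
  [ffun i => (g (complex.Re (v k i 0)), g (complex.Im (v k i 0)))].
have fP k l : f k = f l -> sq (v k - v l) <= e.
  move=> /ffunP fkl.
  have h i : normc ((v k - v l) i 0) ^+ 2 <= 2 * N%:R^-1 ^+ 2.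
    have := fkl i; rewrite !ffunE => -[eR eI].
    have [k1 k2] := coord k i; have [l1 l2] := coord l i.
    have := gP _ _ k1 l1 eR; have := gP _ _ k2 l2 eI.
    rewrite !mxE; case: (v k i 0) (v l i 0) => x y [x' y'] /=.
    by rewrite sqr_sqrtr ?addr_ge0 ?sqr_ge0 //; lra.
  apply: le_trans (ler_sum _ (fun i _ => h i)) _.
  rewrite sumr_const card_ord -mulr_natr.
  have i1 : N%:R^-1 <= 1 :> R by rewrite invf_le1.
  have i0 : 0 <= N%:R^-1 :> R by rewrite invr_ge0 ltW.
  have : (2 * n%:R * N%:R^-1) * N%:R^-1 <= e * 1.
    apply: ler_pM => //; first by rewrite !mulr_ge0 ?ler0n.
    by rewrite ler_pdivrMr.
  lra.
pose K := #|{: {ffun 'I_n -> 'I_m.+1 * 'I_m.+1}}|.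
have /injectivePn[i [j nij fij]] : ~~ injectiveb (fun k : 'I_K.+1 => f k).
  by apply/negP => /injectiveP /leq_card; rewrite card_ord ltnn.
have [lt|gt|eij] := ltngtP (nat_of_ord i) j.
- by exists i, j; split=> //; apply: fP.
- by exists j, i; split=> //; apply: fP.
- by move/eqP: nij; case; apply: val_inj.
Qed.

Section ContractionPowers.
Variables (R : realType) (n : nat) (A P : 'M[R[i]]_n).
Hypotheses (hA : contraction A) (hP : ker_proj (defect A) P).
Hypothesis kerA : forall v : 'cV_n, defect A *m v = 0 -> defect A *m (A *m v) = 0.

Lemma invariant_ker_proj : P *m (A *m P) = A *m P.
Proof.
have [_ GP [Z PZ]] := hP.
have /submx_kerP/submxP[X hX] : forall v : 'cV_n, defect A *m v = 0 ->
    (defect A *m A) *m v = 0.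
  by move=> v /kerA; rewrite mulmxA.
rewrite {1}PZ mulmxBl mul1mx -!mulmxA (mulmxA (defect A)) hX -(mulmxA X) GP.
by rewrite !mulmx0 subr0.
Qed.

Lemma adj_contraction_ker_proj : A^t* *m (A *m P) = P.
Proof.
have [_ GP _] := hP.
by move/eqP: GP; rewrite mulmxBl mul1mx subr_eq0 -mulmxA => /eqP.
Qed.

(** [A^* A P = P] makes [A] injective on the range of [P], so [A P] has the rank of [P]; its range
    lies in that of [P], hence equals it. Transposes turn column spaces into row spaces. *)
Lemma ker_proj_range : exists W, P = A *m P *m W.
Proof.
have sub : ((A *m P)^T <= P^T)%MS.
  by rewrite -[in X in (X <= _)%MS]invariant_ker_proj trmx_mul submxMl.
have rk : (\rank P^T <= \rank (A *m P)^T)%N.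
  by rewrite !mxrank_tr -[X in (\rank X <= _)%N]adj_contraction_ker_proj mxrankM_maxr.
have /submxP[X hX] : (P^T <= (A *m P)^T)%MS.
  by rewrite -(geq_leqif (mxrank_leqif_sup sub)).
by exists X^T; rewrite -[LHS]trmxK hX trmx_mul trmxK.
Qed.

(** The orthogonal complement of the kernel is invariant too: adjoints give [P = W^* P A^*] and
    [P A^* A = P], so [P A = W^* P] absorbs [P] on the right. *)
Lemma ker_proj_comm : P *m A = A *m P.
Proof.
have [W hW] := ker_proj_range; have [Ph _ _] := hP.
have PA : P *m A^t* *m A = P.
  have := congr1 (fun B : 'M_n => B^t*) adj_contraction_ker_proj.
  by rewrite /= !adjM trmxCK Ph.
have PW : P = W^t* *m (P *m A^t*).
  by rewrite -[LHS]Ph [in LHS]hW !adjM Ph.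
have PWA : P *m A = W^t* *m P by rewrite {1}PW -!mulmxA (mulmxA P) PA.
have PAP : P *m A *m P = P *m A by rewrite PWA -mulmxA (ker_proj_idem hP).
by rewrite -PAP -mulmxA invariant_ker_proj.
Qed.

Lemma ker_defect_surj (v : 'cV_n) : defect A *m v = 0 ->
  exists2 w, defect A *m w = 0 & v = A *m w.
Proof.
move=> /(ker_projP _ hP) Pv; have [W hW] := ker_proj_range; have [_ GP _] := hP.
exists (P *m (W *m v)); first by rewrite (mulmxA _ P) GP mul0mx.
by rewrite -[LHS]Pv [in LHS]hW -!mulmxA.
Qed.

Lemma sq_iter_le k l (v : 'cV_n) :
  sq (iter (k + l) (mulmx A) v) <= sq (iter l (mulmx A) v).
Proof. by elim: k => //= k IH; apply: le_trans (hA _) IH. Qed.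

Lemma iter_mulmxB k (v w : 'cV[R[i]]_n) :
  iter k (mulmx A) (v - w) = iter k (mulmx A) v - iter k (mulmx A) w.
Proof. by elim: k => //= k ->; rewrite mulmxBr. Qed.

Lemma iter_ker_proj k (v : 'cV_n) :
  P *m iter k (mulmx A) v = iter k (mulmx A) (P *m v).
Proof. by elim: k => //= k <-; rewrite !mulmxA ker_proj_comm. Qed.

Lemma sq_iter_ker k (v : 'cV_n) : P *m v = v -> sq (iter k (mulmx A) v) = sq v.
Proof.
move=> Pv; elim: k => //= k <-; apply/(defect_eq0 _ hA)/(ker_projP _ hP).
by rewrite iter_ker_proj Pv.
Qed.

(* The squared norms along the orbit decrease, so some consecutive difference
   is small, and off the kernel of the defect it controls the norm itself. *)
Lemma iter_orth_small (v : 'cV_n) (e : R) : P *m v = 0 -> 0 < e ->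
  exists k, sq (iter k (mulmx A) v) <= e.
Proof.
move=> Pv e0; have [_ _ [Z PZ]] := hP; have [M hM] := mulmx_sq_bounded Z.
pose c k := iter k (mulmx A) v.
have bound k : sq (c k) <= `|M| * (sq (c k) - sq (c k.+1)).
  have ck : c k = Z *m (defect A *m c k).
    have : P *m c k = 0.
      by rewrite iter_ker_proj Pv; elim: {+}k => //= l ->; rewrite mulmx0.
    by rewrite PZ mulmxBl mul1mx -mulmxA => /subr0_eq.
  rewrite {1}ck; apply: le_trans (hM _) _.
  apply: le_trans (ler_wpM2r (sq_ge0 _) (ler_norm M)) _.
  by apply: ler_wpM2l => //; apply: defect_le.
have [//|no] := pselect (exists k, sq (c k) <= e).
(* If every squared norm exceeds [e], each step loses at least [d], so the squared norms eventually
   turn negative. *)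
pose d := e / (`|M| + 1).
have M1 : 0 < `|M| + 1 by rewrite ltr_wpDl.
have d0 : 0 < d by rewrite divr_gt0.
have drop k : sq (c k.+1) <= sq (c k) - d.
  have ek : e < sq (c k) by rewrite ltNge; apply/negP => h; apply: no; exists k.
  have : d <= sq (c k) - sq (c k.+1).
    rewrite /d ler_pdivrMr //.
    by have := bound k; have := hA (c k); rewrite /c iterS; lra.
  lra.
have lin k : sq (c k) <= sq v - k%:R * d.
  elim: k => [|k IH]; first by rewrite mul0r subr0.
  by have := drop k; rewrite -natr1 mulrDl mul1r; lra.
pose k := (Num.truncn (sq v / d)).+1.
have : sq v < k%:R * d by rewrite -ltr_pdivrMr // truncnS_gt.
by have := lin k; have := sq_ge0 (c k); lra.
Qed.

(** Two iterates are close by pigeonhole; powers of [A] are isometric on the range of [P], so the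
    earlier one cancels. *)
Lemma iter_ker_recurrent (v : 'cV_n) (N : nat) (e : R) : P *m v = v -> 0 < e ->
  exists2 k, (N < k)%N & sq (iter k (mulmx A) v - v) <= e.
Proof.
move=> Pv e0.
(* Sampling every [N.+1] steps forces the return time beyond [N]. *)
have hb k : sq (iter (k * N.+1) (mulmx A) v) <= sq v by rewrite sq_iter_ker.
have [i [j [ij hij]]] := pigeonhole_close hb e0.
exists ((j - i) * N.+1)%N; first by rewrite leq_pmull // subn_gt0.
rewrite sqBC -(sq_iter_ker (i * N.+1)).
  by rewrite iter_mulmxB -iterD -mulnDl subnKC // ltnW.
by rewrite mulmxBr iter_ker_proj Pv.
Qed.

(** [v - P v] stays small from some time [N] on, and [P v] returns near itself at a time beyond
    [N]. *)
Lemma iter_ker_proj_close (v : 'cV_n) (e : R) : 0 < e ->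
  exists2 k, (0 < k)%N & sq (iter k (mulmx A) v - P *m v) <= e.
Proof.
move=> e0; have e4 : 0 < e / 4 by lra.
have PP := ker_proj_idem hP.
have Pw : P *m (v - P *m v) = 0 by rewrite mulmxBr mulmxA PP subrr.
have [N hN] := iter_orth_small Pw e4.
have PPv : P *m (P *m v) = P *m v by rewrite mulmxA PP.
have [k Nk hk] := iter_ker_recurrent N PPv e4.
exists k; first exact: leq_ltn_trans Nk.
have -> : iter k (mulmx A) v - P *m v
    = iter k (mulmx A) (v - P *m v) + (iter k (mulmx A) (P *m v) - P *m v).
  by rewrite iter_mulmxB addrA subrK.
have := sqD_le2 (iter k (mulmx A) (v - P *m v)) (iter k (mulmx A) (P *m v) - P *m v).
have := sq_iter_le (k - N) N (v - P *m v); rewrite subnK; last exact: ltnW.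
by move=> h1 h2; lra.
Qed.

End ContractionPowers.

(** * Semigroups of contractions indexed by words *)

Section WordOperators.
Variables (R : realType) (n : nat) (S : Type) (T : seq S -> 'M[R[i]]_n).
Hypothesis T_cat : forall s t, T (s ++ t) = T t *m T s.
Hypothesis T_contraction : forall s, contraction (T s).
Variable star : seq S -> Prop.

(** Models the words leading one state to another and fixing the latter; the third clause carries
    condition 6 or 7, the last lets powers of a word stay in [Q]. *)
Definition absorbing (Q : seq S -> Prop) := [/\
  exists u, Q u, forall u, Q u -> star u,
  forall u t, Q u -> star t -> exists2 t1, star t1 & Q (u ++ t ++ t1)
  & forall u v, Q u -> Q v -> Q (u ++ v)].

(** Norm lost while reading [u] cannot be regained by [w]. *)
Lemma ker_defect_cat u w (v : 'cV_n) :
  defect (T (u ++ w)) *m v = 0 -> defect (T u) *m v = 0.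
Proof.
move=> /(defect_eq0 _ (T_contraction _)); rewrite T_cat -mulmxA => h.
apply/(defect_eq0 _ (T_contraction _))/eqP; rewrite eq_le T_contraction /=.
by rewrite -h; apply: T_contraction.
Qed.

(* A word whose defect has maximal rank. *)
Lemma extremal_word (Q : seq S -> Prop) : absorbing Q -> exists u, [/\ Q u,
    forall v : 'cV_n, defect (T u) *m v = 0 -> defect (T u) *m (T u *m v) = 0
  & forall v : 'cV_n, defect (T u) *m v = 0 <->
      (forall t, star t -> sq (T t *m v) = sq v)].
Proof.
move=> [[u0 Qu0] Qstar Qabs Qcat].
pose rk k := `[< exists2 u, Q u & \rank (defect (T u)) = k >].
have rk_ex : exists k, rk k.
  by exists (\rank (defect (T u0))); apply/asboolP; exists u0.
have rk_le k : rk k -> (k <= n)%N by move=> /asboolP[u _ <-]; apply: rank_leq_col.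
case: (ex_maxnP rk_ex rk_le) => k /asboolP[u Qu uk] kmax.
(* Extending [u] can only shrink the kernel, and maximal rank forbids shrinking. *)
have ker_eq w (v : 'cV_n) : Q (u ++ w) -> defect (T u) *m v = 0 ->
    defect (T (u ++ w)) *m v = 0.
  move=> Quw; have sub : (defect (T u) <= defect (T (u ++ w)))%MS.
    by apply/submx_kerP => v'; apply: ker_defect_cat.
  suff /submx_kerP : (defect (T (u ++ w)) <= defect (T u))%MS by apply.
  rewrite -(geq_leqif (mxrank_leqif_sup sub)) uk; apply: kmax.
  by apply/asboolP; exists (u ++ w).
have inv (v : 'cV_n) : defect (T u) *m v = 0 -> defect (T u) *m (T u *m v) = 0.
  move=> hv; apply/(defect_eq0 _ (T_contraction _)).
  have /(defect_eq0 _ (T_contraction _)) := ker_eq u v (Qcat _ _ Qu Qu) hv.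
  rewrite T_cat -mulmxA => ->; apply/esym.
  by apply/(defect_eq0 _ (T_contraction _)).
exists u; split=> // v; split=> [hv t st|]; last first.
  by move=> /(_ u (Qstar _ Qu)) h; apply/(defect_eq0 _ (T_contraction _)).
(* Extensions of [u] read [t] after [u], so [v] is written as [T u *m w] with [w] in the kernel;
   [u ++ t ++ t1] preserves the norm of [w]. *)
have [P hP] := ker_proj_exists (defect_herm (T u)).
have [w hw ->] := ker_defect_surj hP inv hv.
have [t1 _ Qt] := Qabs _ _ Qu st.
have /(defect_eq0 _ (T_contraction _)) := ker_eq _ _ Qt hw.
rewrite !T_cat -!mulmxA => h.
apply/eqP; rewrite eq_le T_contraction /=.
by apply: le_trans (T_contraction u w) _; rewrite -h; apply: T_contraction.
Qed.

Lemma iter_word (Q : seq S -> Prop) u k (v : 'cV_n) :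
    (forall s t, Q s -> Q t -> Q (s ++ t)) -> Q u -> (0 < k)%N ->
  exists2 s, Q s & T s *m v = iter k (mulmx (T u)) v.
Proof.
move=> Qcat Qu; case: k => // k _; elim: k => [|k [s Qs hs]]; first by exists u.
by exists (s ++ u); [exact: Qcat | rewrite T_cat -mulmxA hs].
Qed.

Lemma absorbing_close (Q1 Q2 : seq S -> Prop) (v : 'cV_n) (e : R) :
    absorbing Q1 -> absorbing Q2 -> 0 < e ->
  exists s t, [/\ Q1 s, Q2 t & sq (T s *m v - T t *m v) <= e].
Proof.
move=> a1 a2 e0; have e4 : 0 < e / 4 by lra.
have [u1 [Qu1 inv1 ker1]] := extremal_word a1.
have [u2 [Qu2 inv2 ker2]] := extremal_word a2.
have [P hP1] := ker_proj_exists (defect_herm (T u1)).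
have [P2 hP2] := ker_proj_exists (defect_herm (T u2)).
(* Both kernels are characterized by [star] alone. *)
have eP : P = P2.
  by apply: (ker_proj_uniq hP1 hP2) => w; rewrite ker1 ker2.
rewrite -{P2}eP in hP2.
have [k1 k1p h1] := iter_ker_proj_close (T_contraction u1) hP1 inv1 v e4.
have [k2 k2p h2] := iter_ker_proj_close (T_contraction u2) hP2 inv2 v e4.
case: a1 a2 => _ _ _ cat1 [_ _ _ cat2].
have [s Qs hs] := iter_word v cat1 Qu1 k1p.
have [t Qt ht] := iter_word v cat2 Qu2 k2p.
exists s, t; split=> //; rewrite hs ht.
set a := iter _ _ _; set b := iter _ _ _.
have -> : a - b = (a - P *m v) + (P *m v - b) by rewrite addrA subrK.
by have := sqD_le2 (a - P *m v) (P *m v - b); rewrite (sqBC (P *m v)); lra.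
Qed.

End WordOperators.

(** * Quantum and deterministic automata *)

Section Evolution.
Variables (R : realType) (Sigma : finType) (A : qfa R Sigma).
Local Notation state := (qfa_state A).
Implicit Types (H : {set state}) (v w : l2 R state) (s t : seq (tape_symbol Sigma)).

Lemma sqnormE v : sqnorm v = sq v. Proof. by []. Qed.

Definition proj_mx H : 'M[R[i]]_#|state| :=
  diag_mx (\row_j (enum_val j \in H)%:R).

Lemma projE H v : proj H v = proj_mx H *m v.
Proof.
rewrite mul_diag_mx; apply/colP => j; rewrite !mxE.
by case: ifP; rewrite ?mul1r ?mul0r.
Qed.

Lemma sq_proj_split v :
  sq (proj (qfa_acc A) v) + sq (proj (qfa_rej A) v) + sq (proj (qfa_non A) v)
  = sq v.
Proof.
rewrite /sq -!big_split; apply: eq_bigr => j _; rewrite !mxE !inE.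
have := disjointFr (qfa_disjoint A) (x := enum_val j).
move: (@normc R) (normc0 R) => nrm nrm0.
case: (_ \in qfa_acc A) => [/(_ isT) ->|_] /=; first by rewrite nrm0; ring.
by case: (_ \in qfa_rej A); rewrite /= nrm0; ring.
Qed.

Lemma sq_qfa_trans a v : sq (qfa_trans A a *m v) = sq v.
Proof.
have /unitarymxP/mulmx1C h := qfa_trans_unitary A a.
by rewrite !sqE ip_adj mulmxA h mul1mx.
Qed.

Definition step a := proj_mx (qfa_non A) *m qfa_trans A a.

Definition evolution s : 'M[R[i]]_#|state| :=
  foldl (fun B a => step a *m B) 1%:M s.

Lemma evolution_cat s t : evolution (s ++ t) = evolution t *m evolution s.
Proof.
rewrite /evolution foldl_cat; elim/last_ind: t => [|t a IH]; first by rewrite mul1mx.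
by rewrite !foldl_rcons IH mulmxA.
Qed.

Lemma evolution_cons a s : evolution (a :: s) = evolution s *m step a.
Proof. by rewrite -cat1s evolution_cat /evolution /= mulmx1. Qed.

Lemma halt_prob_cat H v s t :
  halt_prob H v (s ++ t) = halt_prob H v s + halt_prob H (evolution s *m v) t.
Proof.
elim: s v => [|a s IH] v /=; first by rewrite add0r mul1mx.
by rewrite IH addrA evolution_cons /step !projE -!mulmxA.
Qed.

(** Conservation of probability: each letter acts unitarily and the three projections split the
    squared norm. *)
Lemma halt_prob_total v s :
  halt_prob (qfa_acc A) v s + halt_prob (qfa_rej A) v s + sq (evolution s *m v)
  = sq v.
Proof.
elim: s v => [|a s IH] v; first by rewrite /= mul1mx !add0r.
rewrite -[RHS](sq_qfa_trans a) -[RHS]sq_proj_split -[X in _ = _ + X]IH /=.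
by rewrite evolution_cons /step !projE -!mulmxA !sqnormE; ring.
Qed.

Lemma halt_prob_ge0 H v s : 0 <= halt_prob H v s.
Proof. by elim: s v => //= a s IH v; rewrite addr_ge0 ?IH // sq_ge0. Qed.

Lemma evolution_contraction s : contraction (evolution s).
Proof.
move=> v; rewrite -[X in _ <= X](halt_prob_total v s) lerDr.
by rewrite addr_ge0 ?halt_prob_ge0.
Qed.

(** A halting probability is a sum of squared norms of linear images of the start vector, so
    [sqD_le] applies term by term. *)
Lemma halt_prob_perturb H v w s (d : R) : 0 < d ->
  halt_prob H (v + w) s
    <= (1 + d) * halt_prob H v s + (1 + d^-1) * halt_prob H w s.
Proof.
move=> d0; elim: s v w => [|a s IH] v w /=; first by rewrite !mulr0 addr0.
rewrite !projE !mulmxDr -!projE.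
have := sqD_le (proj H (qfa_trans A a *m v)) (proj H (qfa_trans A a *m w)) d0.
have := IH (proj (qfa_non A) (qfa_trans A a *m v))
  (proj (qfa_non A) (qfa_trans A a *m w)).
by rewrite !sqnormE; lra.
Qed.

End Evolution.

Lemma sq_ket (R : realType) (Q : finType) (q : Q) : sq (ket R q) = 1.
Proof.
rewrite /sq (bigD1 (enum_rank q)) //= big1 => [|i ni]; rewrite mxE.
  by rewrite !eqxx addr0 normc1 expr1n.
by rewrite (negPf ni) normc0 expr0n.
Qed.

(** * Reachability in the minimal automaton and words over [x] and [y] *)

Section Automata.
Variable Sigma : finType.

Lemma dfa_read_cat (M : dfa Sigma) (q : dfa_state M) s t :
  dfa_read q (s ++ t) = dfa_read (dfa_read q s) t.
Proof. exact: foldl_cat. Qed.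

(** Restriction to the reachable states recognizes the same language, so by minimality no state can
    be lost. *)
Lemma minimal_dfa_reachable (L : language Sigma) (M : dfa Sigma) :
  minimal_dfa L M -> forall q, exists w, dfa_read (dfa_init M) w = q.
Proof.
move=> [rec min] q.
pose e (p r : dfa_state M) := [exists a, dfa_trans p a == r].
pose reach := connect e (dfa_init M).
have reach_trans (p : {p | reach p}) a : reach (dfa_trans (val p) a).
  apply: connect_trans (valP p) (connect1 _).
  by apply/existsP; exists a.
pose M' := @DFA Sigma {p | reach p} (exist _ (dfa_init M) (connect0 _ _))
  (fun p a => exist _ (dfa_trans (val p) a) (reach_trans p a))
  [set p | val p \in dfa_acc M].
have read' (p : dfa_state M') w : val (dfa_read p w) = dfa_read (val p) w.
  by elim: w p => //= a w IH p; apply: IH.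
have /min : dfa_recognizes M' L by move=> w; rewrite inE read'; apply: rec.
rewrite card_sig => card_le.
have /connectP[s] : reach q.
  apply/negPn/negP => nq; move: card_le; rewrite leqNgt => /negP; apply.
  apply: proper_card; apply/properP; split; first exact/subsetP.
  by exists q.
elim: s (dfa_init M) => [|r s IH] p /=; first by exists [::].
by move=> /andP[/existsP[a /eqP <-]] /IH h /h [w <-]; exists (a :: w).
Qed.

Lemma in_star2_cat (x y s t : seq Sigma) :
  in_star2 x y s -> in_star2 x y t -> in_star2 x y (s ++ t).
Proof.
move=> [u hu ->] [v hv ->]; exists (u ++ v); last by rewrite flatten_cat.
by move=> w; rewrite mem_cat => /orP[/hu|/hv].
Qed.

Lemma in_star2_left (x y : seq Sigma) : in_star2 x y x.
Proof.
exists [:: x]; last by rewrite /= cats0.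
by move=> w; rewrite !inE => ->.
Qed.

Lemma in_star2_right (x y : seq Sigma) : in_star2 x y y.
Proof.
exists [:: y]; last by rewrite /= cats0.
by move=> w; rewrite !inE => ->; rewrite orbT.
Qed.

Lemma absorbing_read (M : dfa Sigma) (x y z : seq Sigma) (q r : dfa_state M) :
    in_star2 x y z -> dfa_read q z = r -> dfa_read r z = r ->
    (forall t, in_star2 x y t ->
       exists2 t1, in_star2 x y t1 & dfa_read r (t ++ t1) = r) ->
  absorbing (in_star2 x y)
    (fun u => [/\ in_star2 x y u, dfa_read q u = r & dfa_read r u = r]).
Proof.
move=> xyz qz rz ret; split=> [|u []//|u t [su qu ru] st|u v [su qu ru] [sv _ rv]].
- by exists z.
- have [t1 st1 rt] := ret _ st; exists t1 => //.
  by split; rewrite ?dfa_read_cat ?qu ?ru -?dfa_read_cat //; do !apply: in_star2_cat.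
- by split; rewrite ?dfa_read_cat ?qu ?ru //; apply: in_star2_cat.
Qed.

Lemma tape_cat (s t z : seq Sigma) : tape (s ++ t ++ z) =
  (Kappa :: map (@Letter Sigma) s) ++ map (@Letter Sigma) t
    ++ rcons (map (@Letter Sigma) z) Dollar.
Proof. by rewrite /tape !map_cat !rcons_cat. Qed.

End Automata.

(** * Contradiction from four halting probabilities *)

Theorem theorem2p1 (R : realType) (Sigma : finType) (L : language Sigma)
  (M : dfa Sigma) (hL : regular L) (hM : minimal_dfa L M)
  (x y z1 z2 : seq Sigma) (q1 q2 q3 : dfa_state M)
  (h1 : q2 <> q3)
  (h2 : dfa_read q1 x = q2)
  (h3 : dfa_read q2 x = q2)
  (h4 : dfa_read q1 y = q3)
  (h5 : dfa_read q3 y = q3)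
  (h6 : forall t, in_star2 x y t ->
     exists2 t1, in_star2 x y t1 & dfa_read q2 (t ++ t1) = q2)
  (h7 : forall t, in_star2 x y t ->
     exists2 t1, in_star2 x y t1 & dfa_read q3 (t ++ t1) = q3)
  (h8 : dfa_read q2 z1 \in dfa_acc M)
  (h9 : dfa_read q2 z2 \notin dfa_acc M)
  (h10 : dfa_read q3 z1 \notin dfa_acc M)
  (h11 : dfa_read q3 z2 \in dfa_acc M) :
  ~ qfa_recognizable R L.
Proof.
move=> [A [p [p_gt [acc rej]]]].
have [w hw] := minimal_dfa_reachable hM q1.
have [rec _] := hM.
(* [p = 1 / 2 + 2 g], so four probabilities total at least [2 + 8 g]; the choice of [e] makes each
   error term of weight [1 + g^-1] at most [g]. *)
pose g := (p - 1 / 2) / 2; have g0 : 0 < g by rewrite /g; lra.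
have K0 : 0 < 1 + g^-1 by rewrite addr_gt0 // invr_gt0.
pose e := g / (1 + g^-1); have e0 : 0 < e by rewrite divr_gt0.
have Ke : (1 + g^-1) * e = g by rewrite mulrC divfK // gt_eqF.
pose T (s : seq Sigma) := evolution A (map (@Letter Sigma) s).
have T_cat s t : T (s ++ t) = T t *m T s by rewrite /T map_cat evolution_cat.
have T_contr s : contraction (T s) := @evolution_contraction _ _ _ _.
pose k := Kappa :: map (@Letter Sigma) w.
pose psi := evolution A k *m ket R (qfa_init A).
have [u [v [[_ q1u _] [_ q1v _] close]]] :
    exists u v, [/\ [/\ in_star2 x y u, dfa_read q1 u = q2 & dfa_read q2 u = q2],
      [/\ in_star2 x y v, dfa_read q1 v = q3 & dfa_read q3 v = q3]
      & sq (T u *m psi - T v *m psi) <= e].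
  apply: (absorbing_close T_cat T_contr) => //.
    exact: absorbing_read (in_star2_left _ _) _ _ _.
  exact: absorbing_read (in_star2_right _ _) _ _ _.
pose pre H s := halt_prob H (ket R (qfa_init A)) (k ++ map (@Letter Sigma) s).
pose post H (phi : l2 R (qfa_state A)) z :=
  halt_prob H phi (rcons (map (@Letter Sigma) z) Dollar).
have prob H s z : halt_prob H (ket R (qfa_init A)) (tape (w ++ s ++ z))
    = pre H s + post H (T s *m psi) z.
  by rewrite tape_cat catA halt_prob_cat evolution_cat -mulmxA.
have pre_total s :
    pre (qfa_acc A) s + pre (qfa_rej A) s + sq (T s *m psi) = 1.
  by rewrite mulmxA -evolution_cat halt_prob_total sq_ket.
have post_total phi z : post (qfa_acc A) phi z + post (qfa_rej A) phi z <= sq phi.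
  by rewrite -[X in _ <= X](halt_prob_total phi (rcons (map (@Letter Sigma) z) Dollar))
    lerDl sq_ge0.
have post_ge0 H phi z : 0 <= post H phi z by exact: halt_prob_ge0.
have read s z : dfa_read (dfa_init M) (w ++ s ++ z) = dfa_read (dfa_read q1 s) z.
  by rewrite !dfa_read_cat hw.
have L1 : p <= pre (qfa_acc A) u + post (qfa_acc A) (T u *m psi) z1.
  by rewrite -prob; apply: acc; rewrite rec read q1u.
have L2 : p <= pre (qfa_rej A) u + post (qfa_rej A) (T u *m psi) z2.
  by rewrite -prob; apply: rej; rewrite rec read q1u; apply/negP.
have L3 : p <= pre (qfa_rej A) v + post (qfa_rej A) (T v *m psi) z1.
  by rewrite -prob; apply: rej; rewrite rec read q1v; apply/negP.
have L4 : p <= pre (qfa_acc A) v + post (qfa_acc A) (T v *m psi) z2.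
  by rewrite -prob; apply: acc; rewrite rec read q1v.
move: close L1 L2 L3 L4 (pre_total u) (pre_total v).
set a := T u *m psi; set b := T v *m psi => close L1 L2 L3 L4 tu tv.
have Kclose t : t <= sq (a - b) -> (1 + g^-1) * t <= g.
  by move=> h; rewrite -[X in _ <= X]Ke ler_pM2l //; apply: le_trans h close.
have ba : b = a + (b - a) by rewrite addrC subrK.
(* The two probabilities starting from [b] are transferred to [a], and [sq a] is compared with
   [sq b]; each of the three estimates costs at most [2 g]. *)
have near1 := halt_prob_perturb (qfa_rej A) a (b - a)
  (rcons (map (@Letter Sigma) z1) Dollar) g0.
have near2 := halt_prob_perturb (qfa_acc A) a (b - a)
  (rcons (map (@Letter Sigma) z2) Dollar) g0.
have near3 := sqD_le b (a - b) g0.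
rewrite -ba -!/(post _ _ _) in near1 near2; rewrite addrC subrK in near3.
have d1 : (1 + g^-1) * post (qfa_rej A) (b - a) z1 <= g.
  apply: Kclose; rewrite sqBC; have := post_total (b - a) z1.
  by have := post_ge0 (qfa_acc A) (b - a) z1; lra.
have d2 : (1 + g^-1) * post (qfa_acc A) (b - a) z2 <= g.
  apply: Kclose; rewrite sqBC; have := post_total (b - a) z2.
  by have := post_ge0 (qfa_rej A) (b - a) z2; lra.
have d3 := Kclose _ (lexx _).
have t1 := post_total a z1; have t2 := post_total a z2.
have sa : sq a <= 1.
  by rewrite -tu lerDr addr_ge0 // halt_prob_ge0.
have sb : sq b <= 1 by rewrite -tv lerDr addr_ge0 // halt_prob_ge0.
have m1 : g * post (qfa_rej A) a z1 <= g.
  by rewrite ler_piMr ?(ltW g0) //; have := post_ge0 (qfa_acc A) a z1; lra.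
have m2 : g * post (qfa_acc A) a z2 <= g.
  by rewrite ler_piMr ?(ltW g0) //; have := post_ge0 (qfa_rej A) a z2; lra.
have m3 : g * sq b <= g by rewrite ler_piMr ?(ltW g0) //.
have gE : 2 * g = p - 1 / 2 by rewrite /g; lra.
(* Summing [L1] to [L4] gives [2 + 8 g <= 2 + sq a - sq b + 4 g <= 2 + 6 g]. *)
move: p_gt; rewrite ltNge => /negP; apply; lra.
Qed.
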